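(* Let $q$ be a prime power and let $n$ be a positive integer with $n\le q^q$. Then there exists an explicit weak $(n,q,l,\rho)$-design with $l=q^2$ and $\rho<(1+q^{-1})^q<e$, namely the refined Nisan–Wigderson design $S_0,\dots,S_{n-1}$. That is, there is a real number $\rho<(1+q^{-1})^q<e$ such that the sets $S_0,\dots,S_{n-1}\subseteq GF(q)\times GF(q)\cong[q^2]$ of the refined Nisan–Wigderson design satisfy $|S_i|=q$ and $\sum_{j<i}2^{|S_i\cap S_j|}\le (i+1)\rho$ for all $i\in[n]$.
   Context: Notation: $[m]=\{0,1,\dots,m-1\}$; $e$ is the base of the natural logarithm; $GF(q)$ is the finite field with $q=p^r$ elements, $p$ prime, $r\ge1$. The set $[q]$ is identified with $GF(q)$ by a fixed bijection (via strings of $p$-ary digits) under which the integers $0$ and $1$ correspond to the field elements $0$ and $1$. With $l=q^2$, the set $[l]$ is identified with $GF(q)\times GF(q)$ by a fixed bijection. Weak design: a family of sets $S_0,\dots,S_{n-1}\subseteq[l]$ is a weak $(n,q,l,\rho)$-design if (1) $|S_i|=q$ for all $i\in[n]$, and (2) $\sum_{j<i}2^{|S_i\cap S_j|}\le (i+1)\rho$ for all $i\in[n]$. (Condition (2) is a slightly stronger form of the usual condition $\sum_{j<i}2^{|S_i\cap S_j|}\le n\rho$ for all $i\in[n]$.) Refined Nisan–Wigderson design: for $i\in[n]$, where $n\le q^q$, let $\phi_i(x)=\sum_{k\ge0}\left(\lfloor i/q^k\rfloor \bmod q\right)x^k$, a polynomial over $GF(q)$ whose coefficients are the base-$q$ digits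 of $i$, regarded as elements of $GF(q)$ (all but finitely many are $0$, and the degree is at most $q-1$). Put $S_i=\{(j,\phi_i(j)) : j\in GF(q)\}\subseteq GF(q)\times GF(q)\cong[q^2]$. *)

(* Defs.v *)
From mathcomp Require Import all_boot all_order all_algebra.
From mathcomp Require Import reals sequences exp.

Set Implicit Arguments.
Unset Strict Implicit.
Unset Printing Implicit Defensive.

Import GRing.Theory.

Local Open Scope ring_scope.

Definition prime_power (q : nat) : Prop :=
  exists p r : nat, [/\ prime p, (0 < r)%N & q = (p ^ r)%N].

Lemma prime_power_gt0 (q : nat) : prime_power q -> (0 < q)%N.
Proof. by case=> p [r [p_pr _ ->]]; rewrite expn_gt0 prime_gt0. Qed.

(* The sum is bounded by (i + 1) * rho for each i, which is slightly stronger
   than the usual bound n * rho. *)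
Definition weak_design (R : realType) (n q l : nat) (rho : R)
    (S : 'I_n -> {set 'I_l}) : Prop :=
  (forall i : 'I_n, #|S i| = q) /\
  (forall i : 'I_n,
     (\sum_(j < n | (j < i)%N) 2 ^ #|S i :&: S j|)%N%:R <= i.+1%:R * rho).

Definition digit (q : nat) (q_gt0 : (0 < q)%N) (i k : nat) : 'I_q :=
  Ordinal (ltn_pmod (i %/ q ^ k) q_gt0).

(* The bijection beta identifies [q] = {0, ..., q-1} with the field F = GF(q).
   It is arbitrary except that the integers 0 and 1 go to the field elements
   0 and 1; encoding p-ary digit strings by coordinates in an F_p-basis of F
   starting with 1 is one such bijection. *)
Definition field_identification (q : nat) (F : finFieldType)
    (beta : 'I_q -> F) : Prop :=
  [/\ bijective beta,
      forall d : 'I_q, d = 0%N :> nat -> beta d = 0 &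
      forall d : 'I_q, d = 1%N :> nat -> beta d = 1].

(* For i < q ^ q all base-q digits of rank at least q vanish (and beta sends
   the digit 0 to 0), so truncating the sum over all k to k < q loses
   nothing. *)
Definition NW_poly (q : nat) (q_gt0 : (0 < q)%N) (F : finFieldType)
    (beta : 'I_q -> F) (i : nat) : {poly F} :=
  \poly_(k < q) beta (digit q_gt0 i k).

(* The graph of the i-th polynomial, transported from F * F to [q ^ 2] by the
   identification gamma. *)
Definition refined_NW (q : nat) (q_gt0 : (0 < q)%N) (F : finFieldType)
    (beta : 'I_q -> F) (gamma : F * F -> 'I_(q ^ 2)) (i : nat) :
    {set 'I_(q ^ 2)} :=
  [set gamma (x, (NW_poly q_gt0 beta i).[x]) | x in F].

(* Main.v *)
Require Import Defs.
From mathcomp Require Import all_boot all_order all_algebra.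
From mathcomp Require Import reals sequences exp.

(** For a set A of a points of GF(q), two polynomials whose digits of rank at
    least a coincide and which agree on A are equal, since their difference has
    degree less than a.  Hence each block of q^a consecutive indices contains at
    most one j such that phi_j agrees with phi_i on A; the block of i itself is
    used up by i, so at most i / q^a indices j < i remain.  Writing
    2^|S_i :&: S_j| as the number of sets A on which phi_i and phi_j agree and
    summing over A bounds the sum by i (1 + 1/q)^q.  As i < n, the constant
    rho = (n - 1) / n (1 + 1/q)^q works. *)

Set Implicit Arguments.
Unset Strict Implicit.
Unset Printing Implicit Defensive.

Import Order.TTheory GRing.Theory Num.Theory.

Local Open Scope ring_scope.

Lemma eq_digits (q : nat) (q_gt0 : (0 < q)%N) (a i j : nat) :
    (forall k, (k < a)%N -> digit q_gt0 i k = digit q_gt0 j k) ->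
  (i %/ q ^ a)%N = (j %/ q ^ a)%N -> i = j.
Proof.
elim: a => [|a IHa] eq_ij; first by rewrite expn0 !divn1.
rewrite expnSr !divnMA => eq_div; apply: IHa => [k lt_ka|].
  by apply: eq_ij; apply: ltnW.
rewrite (divn_eq (i %/ q ^ a) q) (divn_eq (j %/ q ^ a) q) eq_div.
by congr (_ + _)%N; apply: (congr1 val (eq_ij a _)).
Qed.

Lemma digit_high (q : nat) (q_gt0 : (0 < q)%N) (a i j k : nat) :
    (i %/ q ^ a)%N = (j %/ q ^ a)%N -> (a <= k)%N ->
  digit q_gt0 i k = digit q_gt0 j k.
Proof.
move=> eq_ij le_ak; apply: val_inj => /=.
by rewrite -(subnKC le_ak) expnD !divnMA eq_ij.
Qed.

Lemma poly_eq_on_set (F : finFieldType) (A : {set F}) (p1 p2 : {poly F}) :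
    (size (p1 - p2)%R <= #|A|)%N -> {in A, forall x, p1.[x] = p2.[x]} ->
  p1 = p2.
Proof.
move=> le_size eqA; apply/eqP; rewrite -subr_eq0; apply: contraTT le_size => nz.
rewrite -ltnNge cardE; apply: max_poly_roots nz _ (enum_uniq _).
apply/allP=> x; rewrite mem_enum => Ax.
by rewrite rootE hornerD hornerN eqA // subrr.
Qed.

Section Agreement.

Variables (q : nat) (q_gt0 : (0 < q)%N) (F : finFieldType).
Variables (beta : 'I_q -> F).

Local Notation phi := (NW_poly q_gt0 beta).

Definition agree (i j : nat) : {set F} := [set x | (phi i).[x] == (phi j).[x]].

(** Points of two graphs coincide only over the same abscissa, so the intersection is the injective
    image of the agreement set under [x => gamma (x, (phi i).[x])]. *)
Lemma agree_card (gamma : F * F -> 'I_(q ^ 2)) (i j : nat) :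
    injective gamma ->
  #|refined_NW q_gt0 beta gamma i :&: refined_NW q_gt0 beta gamma j|
    = #|agree i j|.
Proof.
move=> inj_g; rewrite -(card_imset (f := fun x => gamma (x, (phi i).[x]))).
  apply: eq_card => y; rewrite inE; apply/andP/imsetP.
    case=> /imsetP[x _ ->] /imsetP[z _ /inj_g[<- eq_x]].
    by exists x; rewrite // inE eq_x.
  case=> x; rewrite inE => /eqP eq_x ->; split; first exact: imset_f.
  by rewrite eq_x; apply: imset_f.
by move=> x y /inj_g[].
Qed.

Lemma NW_poly_block_inj (A : {set F}) (i j : nat) :
    injective beta -> (#|A| <= q)%N -> A \subset agree i j ->
  (i %/ q ^ #|A|)%N = (j %/ q ^ #|A|)%N -> i = j.
Proof.
move=> inj_b leAq /subsetP sAij eq_ij.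
have eq_phi : phi i = phi j.
  apply: (poly_eq_on_set (A := A)) => [|x /sAij]; last by rewrite inE => /eqP.
  apply/leq_sizeP => k le_k; rewrite coefB !coef_poly (digit_high _ eq_ij le_k).
  by rewrite subrr.
apply: (eq_digits (q_gt0 := q_gt0) _ eq_ij) => k lt_k; apply: inj_b.
(* The rank [k] lies below the truncation in [NW_poly], so the coefficient is the image of the
   digit. *)
have lt_kq : (k < q)%N by apply: leq_trans leAq.
by have := congr1 (fun p : {poly F} => p`_k) eq_phi; rewrite !coef_poly lt_kq.
Qed.

Lemma agree_count (A : {set F}) (n i : nat) :
    injective beta -> (#|A| <= q)%N ->
  (\sum_(j < n | (j < i)%N && (A \subset agree i j)) 1 <= i %/ q ^ #|A|)%N.
Proof.
move=> inj_b leAq; rewrite sum1_card cardE.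
set s := enum _; rewrite -(size_map (fun j : 'I_n => j %/ q ^ #|A|)%N).
(* The quotients of the counted indices are distinct and lie in the interval from 0 to
   [i %/ q ^ #|A|], right end excluded. *)
rewrite -[leqRHS](size_iota 0); apply: uniq_leq_size.
  rewrite map_inj_in_uniq ?enum_uniq // => j k.
  rewrite !mem_enum => /andP[_ sAj] /andP[_ sAk] eq_jk; apply: val_inj.
  apply: (NW_poly_block_inj inj_b leAq _ eq_jk); apply/subsetP => x Ax.
  move: (subsetP sAj x Ax) (subsetP sAk x Ax).
  by rewrite !inE => /eqP<- /eqP<-.
move=> m /mapP[j]; rewrite mem_enum => /andP[lt_ji sAj] ->.
rewrite mem_iota /= add0n ltn_neqAle leq_div2r 1?ltnW // andbT.
(* The quotient of [i] is not attained: it would force [j = i]. *)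
apply: contraTneq lt_ji => eq_ji.
by rewrite (NW_poly_block_inj inj_b leAq sAj (esym eq_ji)) ltnn.
Qed.

Lemma sum_agree (n i : nat) : injective beta -> (#|F| <= q)%N ->
  (\sum_(j < n | (j < i)%N) 2 ^ #|agree i j|
     <= \sum_(A : {set F}) i %/ q ^ #|A|)%N.
Proof.
move=> inj_b leFq.
under eq_bigr do rewrite -card_powerset -sum1_card.
under eq_bigr do under eq_bigl do rewrite powersetE.
rewrite (exchange_big_dep xpredT) //=; apply: leq_sum => A _.
exact: agree_count (leq_trans (max_card _) leFq).
Qed.

End Agreement.

(** Expand the product of [x + 1] over [T]: [A] collects the factors that contribute [x]. *)
Lemma sum_expr_card (R : comNzRingType) (T : finType) (x : R) :
  \sum_(A : {set T}) x ^+ #|A| = (1 + x) ^+ #|T|.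
Proof.
transitivity (\prod_(t : T) (x + 1)).
  rewrite bigA_distr; apply: eq_bigr => A _.
  by rewrite -big_mkcond /= prodr_const.
by rewrite prodr_const addrC.
Qed.

Lemma natr_divn_le (R : numFieldType) (m d : nat) :
  (m %/ d)%N%:R <= m%:R / d%:R :> R.
Proof.
case: d => [|d]; first by rewrite divn0 invr0 mulr0.
by rewrite ler_pdivlMr ?ltr0n // -natrM ler_nat leq_divM.
Qed.

(** Take the [q]-th power of [1 + x < expR x] at [x = q%:R^-1], which is nonzero. *)
Lemma lt_expr_expR1 (R : realType) (q : nat) : (0 < q)%N ->
  (1 + q%:R^-1) ^+ q < expR (1 : R).
Proof.
move=> q_gt0; have q_neq0 : q%:R != 0 :> R by rewrite pnatr_eq0 -lt0n.
have -> : expR (1 : R) = expR q%:R^-1 ^+ q.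
  by rewrite -expRM_natl mulfV.
rewrite ltr_pXn2r ?nnegrE ?expR_ge0 ?addr_ge0 ?invr_ge0 ?ler0n //.
by rewrite expR_gt1Dx // invr_eq0.
Qed.

Theorem mainTheorem1 (R : realType) (q n : nat) (hq : prime_power q)
    (n_gt0 : (0 < n)%N) (n_le : (n <= q ^ q)%N)
    (F : finFieldType) (cardF : #|F| = q)
    (beta : 'I_q -> F) (hbeta : field_identification beta)
    (gamma : F * F -> 'I_(q ^ 2)) (hgamma : bijective gamma) :
  exists rho : R,
    [/\ rho < (1 + q%:R^-1) ^+ q,
        (1 + q%:R^-1) ^+ q < expR (1 : R) &
        weak_design q rho
          (fun i : 'I_n => refined_NW (prime_power_gt0 hq) beta gamma i)].
Proof.
have q_gt0 := prime_power_gt0 hq; have [/bij_inj inj_b _ _] := hbeta.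
have inj_g := bij_inj hgamma; set c : R := (1 + q%:R^-1) ^+ q.
have c_gt0 : 0 < c by rewrite exprn_gt0 // addr_gt0 // invr_gt0 ltr0n.
exists (n.-1%:R / n%:R * c); split; last split=> i.
- by rewrite gtr_pMl // ltr_pdivrMr ?ltr0n // mul1r ltr_nat prednK.
- exact: lt_expr_expR1.
- by rewrite card_imset // => x y /inj_g[].
under eq_bigr do rewrite agree_card //.
have le_sum : (\sum_(j < n | (j < i)%N)
    2 ^ #|agree (prime_power_gt0 hq) beta i j|)%N%:R <= i%:R * c.
  apply: (@le_trans _ _ (\sum_(A : {set F}) i %/ q ^ #|A|)%N%:R).
    by rewrite ler_nat sum_agree // cardF.
  (* Reading the exponent [q] as [#|F|] turns [c] into the sum of [q ^- #|A|] over all [A], so the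
     bound is checked termwise. *)
  rewrite /c -[X in _ ^+ X]cardF -sum_expr_card natr_sum mulr_sumr.
  by apply: ler_sum => A _; rewrite exprVn -natrX natr_divn_le.
apply: le_trans le_sum _; rewrite mulrA ler_pM2r // mulrA.
rewrite ler_pdivlMr ?ltr0n // -!natrM ler_nat.
(* After clearing denominators, [i * n <= i.+1 * n.-1] reduces to [i <= n.-1]. *)
rewrite -[X in (_ * X <= _)%N](prednK n_gt0) mulnS mulSn.
by rewrite leq_add2r -ltnS prednK.
Qed.
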